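(* No vertex cover-based algorithm has competitive ratio better than $\frac32$ for the hypergraph orientation problem: for every $\eta>0$ there is an instance on which every vertex cover-based algorithm $A$ has $\mathbb E[A]\ge(\frac32-\eta)\mathbb E[\mathrm{OPT}]$. This holds even within each of the following classes of instances: (1) instances with a single hyperedge (with non-uniform query costs); (2) instances with uniform query costs whose vertex cover instance $\bar G$ is bipartite; (3) graph orientation instances with uniform query costs whose graph is not bipartite.
   Context: An instance of the hypergraph orientation problem consists of a hypergraph $H=(V,E)$ and, for each vertex $v\in V$, a query cost $c_v\ge 0$ and a continuous probability distribution $d_v$; $I_v=(\ell_v,r_v)$ is the minimal open interval containing its support. The weights $w_v\sim d_v$ are drawn independently; querying $v$ reveals $w_v$ at cost $c_v$. For a realization, $Q\subseteq V$ is a feasible query set if knowing $w_u$ for $u\in Q$ and only the intervals $I_u$ for $u\notin Q$ suffices to identify a minimum-weight vertex of every hyperedge; $\mathrm{OPT}(R)$ is the minimum cost of a feasible query set for realization $R$, and $\mathbb E[\mathrm{OPT}]$ its expectation; $\mathbb E[A]$ is the expected query cost of algorithm $A$. Uniform query costs means $c_v=1$ for all $v$; the graph orientation problem is the case where all hyperedges have two vertices. The leftmost vertex of a hyperedge is one with minimum $\ell_v$. The vertex cover instance of $H$ is the graph $\bar G=(V,\bar E)$ where $\{v,u\}\in\bar E$ iff some hyperedge $F$ contains both $u,v$, $v$ is leftmost in $F$, and $I_v\cap I_u\ne\emptyset$. A vertex cover-based algorithm (1) first non-adaptively queries some vertex cover $VC$ of $\bar G$, and then (2) for each hyperedge whose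 minimum-weight vertex is not yet known, queries its unqueried vertices in order of non-decreasing left endpoints until the minimum-weight vertex of the hyperedge is known. *)

(* Defs.v *)
From HB Require Import structures.
From mathcomp Require Import all_boot all_order all_algebra.
From mathcomp Require Import all_classical all_reals all_analysis.
Set Implicit Arguments. Unset Strict Implicit. Unset Printing Implicit Defensive.
Import Order.TTheory GRing.Theory Num.Theory.
Local Open Scope ring_scope.
Local Open Scope classical_set_scope.

Record instance (R : realType) (V : finType) := Instance {
  hedges : {set {set V}};
  cost   : V -> R;
  dist   : V -> probability R R;
  lft    : V -> R;
  rgt    : V -> R
}.

Section Defs.
Context {R : realType} {V : finType} (I : instance R V).

Definition oitv (a b : R) : set R := [set x | a < x < b].

(* Well-formedness: nonempty hyperedges, c_v >= 0, d_v continuous (atomless),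
   and I_v = (l_v, r_v) is the minimal open interval containing the support
   of d_v: d_v puts full mass on (l_v, r_v) and positive mass on every
   neighbourhood of l_v and of r_v inside it. *)
Definition wf_instance : Prop :=
  [/\ forall F, F \in hedges I -> (0 < #|F|)%N,
      forall v, 0 <= cost I v,
      forall v, lft I v < rgt I v,
      forall v (x : R), dist I v [set x] = 0%E &
      forall v, dist I v (oitv (lft I v) (rgt I v)) = 1%E /\
      forall v (e : R), 0 < e ->
        (0 < dist I v (oitv (lft I v) (lft I v + e)))%E /\
        (0 < dist I v (oitv (rgt I v - e) (rgt I v)))%E].

Definition consistent (Q : {set V}) (w w' : V -> R) : Prop :=
  forall u, (u \in Q -> w' u = w u) /\
            (u \notin Q -> lft I u < w' u < rgt I u).

Definition known_min (Q : {set V}) (w : V -> R) (F : {set V}) : Prop :=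
  exists2 v, v \in F &
    forall w', consistent Q w w' -> forall u, u \in F -> w' v <= w' u.

Definition feasible (w : V -> R) (Q : {set V}) : Prop :=
  forall F, F \in hedges I -> known_min Q w F.

Definition qcost (Q : {set V}) : R := \sum_(u in Q) cost I u.

(* OPT(w): minimum cost of a feasible query set (V itself is always feasible). *)
Definition OPT (w : V -> R) : R :=
  \big[Num.min/qcost [set: V]%SET]_(Q : {set V} | `[< feasible w Q >]) qcost Q.

Definition leftmost (F : {set V}) (v : V) : bool :=
  (v \in F) && [forall x in F, lft I v <= lft I x].

Definition barE (u v : V) : bool :=
  (u != v) &&
  [exists F in hedges I,
     [&& u \in F, v \in F, leftmost F u || leftmost F v &
         Num.max (lft I u) (lft I v) < Num.min (rgt I u) (rgt I v)]].

Definition vertex_cover (C : {set V}) : Prop :=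
  forall u v, barE u v -> (u \in C) || (v \in C).

(* A (deterministic) vertex cover-based algorithm: the cover queried in
   phase (1), an adaptive choice of the next unresolved hyperedge to
   process, and an adaptive tie-breaking rule among unqueried vertices of
   minimal left endpoint. *)
Record vc_algorithm := VCAlg {
  vc : {set V};
  next_edge : {set V} -> (V -> R) -> option {set V};
  next_vertex : {set V} -> (V -> R) -> {set V} -> V
}.

Definition valid_algorithm (A : vc_algorithm) : Prop :=
  [/\ vertex_cover (vc A),
      (* choices depend only on the revealed information *)
      (forall (Q : {set V}) (w w' : V -> R), {in Q, w =1 w'} ->
         next_edge A Q w = next_edge A Q w' /\
         forall F, next_vertex A Q w F = next_vertex A Q w' F),
      (forall (Q : {set V}) w, match next_edge A Q w with
                   | Some F => F \in hedges I /\ ~ known_min Q w F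
                   | None => feasible w Q
                   end) &
      (forall (Q : {set V}) w F, F \in hedges I -> ~ known_min Q w F ->
         [/\ next_vertex A Q w F \in F, next_vertex A Q w F \notin Q &
             forall u, u \in F -> u \notin Q ->
               lft I (next_vertex A Q w F) <= lft I u])].

Fixpoint phase2 (A : vc_algorithm) (w : V -> R) (n : nat) (Q : {set V})
  (cur : option {set V}) : {set V} :=
  match n with
  | 0 => Q
  | n'.+1 =>
    match cur with
    | Some F => if `[< known_min Q w F >] then phase2 A w n' Q None
                else phase2 A w n' ((next_vertex A Q w F |: Q)%SET) (Some F)
    | None => match next_edge A Q w with
              | Some F => phase2 A w n' Q (Some F)
              | None => Q
              end
    end
  end.

(* Set of vertices queried by the algorithm on realization w
   (the fuel 3|V|+3 is enough for the run to terminate). *)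
Definition alg_queries (A : vc_algorithm) (w : V -> R) : {set V} :=
  phase2 A w (3 * #|V| + 3) (vc A) None.

Definition alg_cost (A : vc_algorithm) (w : V -> R) : R :=
  qcost (alg_queries A w).

(* Expectation w.r.t. the independent product of the d_v, written as an
   iterated integral (one coordinate at a time). *)
Fixpoint iexp (s : seq V) (f : (V -> R) -> \bar R) (w : V -> R) : \bar R :=
  match s with
  | [::] => f w
  | v :: s' => (\int[dist I v]_x iexp s' f (fun u => if u == v then x else w u))%E
  end.

Definition expect (f : (V -> R) -> \bar R) : \bar R :=
  iexp (enum V) f (fun _ => 0).

Definition E_OPT : \bar R := expect (fun w => (OPT w)%:E).
Definition E_alg (A : vc_algorithm) : \bar R := expect (fun w => (alg_cost A w)%:E).

(* The instance witnesses the bound 3/2 - eta against every vertex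
   cover-based algorithm (with E[OPT] > 0, so the ratio is meaningful). *)
Definition vc_lower_bound (eta : R) : Prop :=
  (0 < E_OPT)%E /\
  forall A, valid_algorithm A -> ((3 / 2 - eta)%:E * E_OPT <= E_alg A)%E.

Definition uniform_costs : Prop := forall v, cost I v = 1.
Definition single_hyperedge : Prop := exists F, hedges I = [set F]%SET.
Definition nonuniform_costs : Prop := exists u v, cost I u != cost I v.
Definition barG_bipartite : Prop :=
  exists col : V -> bool, forall u v, barE u v -> col u != col v.
Definition graph_instance : Prop := forall F, F \in hedges I -> #|F| = 2%N.
Definition graph_bipartite : Prop :=
  exists col : V -> bool, forall F, F \in hedges I ->
    forall u v, u \in F -> v \in F -> u != v -> col u != col v.

End Defs.

(* Main.v *)
(* A hub [x] with interval (1,5) is joined to n pairs of leaves a_i, b_i with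
   intervals (0,4) and (2,6).  The weight of the hub is uniform on (1,2) or on
   (4,5), each with probability 1/2.  Up to a small mass [delta], needed only
   to realize the intervals, b_i lies in (4,6) and a_i lies in (3,4) (one
   hyperedge {x, a_i, b_i} per pair) or in (0,1) (edges {x, a_i}, {x, b_i},
   {a_i, b_i}).  With probability close to 1, a small hub weight makes every
   a_i mandatory and {x, a_1, .., a_n} feasible, and a large one does the same
   for the b_i; so OPT is about n.  A vertex cover contains a_i or b_i for
   every i, before the side needed is known, so an algorithm pays on average
   at least n + n/2.  With a free hub, n = 1 suffices. *)
Require Import Defs.
From HB Require Import structures.
From mathcomp Require Import all_boot all_order all_algebra.
From mathcomp Require Import all_classical all_reals all_analysis.
From mathcomp Require Import measurable_realfun.
From mathcomp Require Import ring lra zify.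
Set Implicit Arguments. Unset Strict Implicit. Unset Printing Implicit Defensive.
Import Order.TTheory GRing.Theory Num.Theory.
Local Open Scope ring_scope.
Local Open Scope classical_set_scope.

(** * Integral bounds valid without measurability of the integrand *)

Section integral_bounds.
Local Open Scope ereal_scope.
Context {d} {T : measurableType d} {R : realType}.
Import HBNNSimple.

(* The integral of a nonnegative function is a supremum over the simple
   functions below it, so it is monotone even without measurability: the
   choices of an algorithm may depend on the weights in a nonmeasurable way. *)
Lemma ge0_le_integral_nomeas (mu : {measure set T -> \bar R}) (f g : T -> \bar R) :
  (forall x, 0 <= f x) -> (forall x, f x <= g x) ->
  \int[mu]_x f x <= \int[mu]_x g x.
Proof.
move=> f0 fg; have g0 x : 0 <= g x by apply: le_trans (fg x).
rewrite !ge0_integralTE//; apply: ereal_sup_le => _ [h hf <-].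
by exists h => // x; apply: le_trans (fg x).
Qed.

(** Disjointness puts the simple function equal to [a] on [A], [b] on [B] and 0 elsewhere below
    [f]. *)
Lemma integral_ge_two_sets (P : probability T R) (A B : set T) (a b : R)
    (f : T -> \bar R) : measurable A -> measurable B -> A `&` B = set0 ->
  (0 <= a)%R -> (0 <= b)%R -> (forall x, 0 <= f x) ->
  (forall x, A x -> a%:E <= f x) -> (forall x, B x -> b%:E <= f x) ->
  a%:E * P A + b%:E * P B <= \int[P]_x f x.
Proof.
move=> mA mB AB0 a0 b0 f0 fA fB.
have mI (C : set T) (c : R) : measurable C ->
    measurable_fun [set: T] (fun x => c%:E * (\1_C x)%:E).
  move=> mC; apply/measurable_EFinP; apply: measurable_funM => //.
suff -> : a%:E * P A + b%:E * P B =
    \int[P]_x (a%:E * (\1_A x)%:E + b%:E * (\1_B x)%:E).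
  apply: ge0_le_integral_nomeas => x.
    by rewrite -!EFinM -EFinD lee_fin addr_ge0// mulr_ge0// indicE.
  rewrite !indicE; have [xA|xA] := boolP (x \in A).
    have -> : (x \in B) = false.
      apply/negP => xB; suff : set0 x by [].
      by rewrite -AB0; split; exact: set_mem.
    by rewrite mule1 mule0 adde0; exact: fA (set_mem xA).
  have [xB|xB] := boolP (x \in B).
    by rewrite mule0 mule1 add0e; exact: fB (set_mem xB).
  by rewrite !mule0 adde0.
rewrite ge0_integralD//; last 4 first.
- by move=> x _; rewrite -EFinM lee_fin mulr_ge0// indicE.
- exact: mI.
- by move=> x _; rewrite -EFinM lee_fin mulr_ge0// indicE.
- exact: mI.
rewrite !ge0_integralZl_EFin//; last 2 first.
- by apply/measurable_EFinP.
- by apply/measurable_EFinP.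
by rewrite !integral_indic// !setIT.
Qed.

Lemma integral_ge_set (P : probability T R) (A : set T) (a : R)
    (f : T -> \bar R) : measurable A -> (0 <= a)%R -> (forall x, 0 <= f x) ->
  (forall x, A x -> a%:E <= f x) -> a%:E * P A <= \int[P]_x f x.
Proof.
move=> mA a0 f0 fA.
have := @integral_ge_two_sets P A set0 a 0 f mA measurable0 (setI0 A) a0 (lexx _) f0 fA.
by rewrite mul0e adde0; apply.
Qed.

Lemma integral_le_set (P : probability T R) (A : set T) (a b : R)
    (f : T -> \bar R) : measurable A -> (0 <= a)%R -> (0 <= b)%R ->
  (forall x, 0 <= f x) -> (forall x, f x <= (a + b)%:E) ->
  (forall x, A x -> f x <= a%:E) -> \int[P]_x f x <= a%:E + b%:E * P (~` A).
Proof.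
move=> mA a0 b0 f0 fab fA.
have mC := measurableC mA.
have mI : measurable_fun [set: T] (fun x => b%:E * (\1_(~` A) x)%:E).
  by apply/measurable_EFinP; apply: measurable_funM.
have -> : a%:E + b%:E * P (~` A) = \int[P]_x (a%:E + b%:E * (\1_(~` A) x)%:E).
  rewrite ge0_integralD//; last by move=> x _; rewrite -EFinM lee_fin mulr_ge0// indicE.
  rewrite integral_cst//= [X in a%:E * X]probability_setT mule1 ge0_integralZl_EFin//; last first.
    exact/measurable_EFinP.
  by rewrite integral_indic// setIT.
apply: ge0_le_integral_nomeas => // x; rewrite indicE.
have [xA|xA] := boolP (x \in ~` A); first by rewrite mule1.
rewrite mule0 adde0; apply: fA; apply: contrapT => nA.
by move/negP: xA; apply; rewrite inE.
Qed.

End integral_bounds.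

(** * Iterated integrals against a product box *)

Section iterated_integral.
Context {R : realType} {V : finType} (I : instance R V).
Implicit Types (s : seq V) (f : (V -> R) -> \bar R) (w : V -> R).
Local Open Scope ereal_scope.

Lemma iexp_ge0 s f w : (forall w, 0 <= f w) -> 0 <= iexp I s f w.
Proof.
move=> f0; elim: s w => //= v s IH w; apply: integral_ge0 => x _; exact: IH.
Qed.

Lemma iexp_le_cst s f w (K : R) : (forall w, 0 <= f w) ->
  (forall w, f w <= K%:E) -> iexp I s f w <= K%:E.
Proof.
move=> f0 fK; elim: s w => //= v s IH w.
have K0 : (0 <= K)%R by rewrite -lee_fin (le_trans (f0 w)).
rewrite (_ : K%:E = K%:E + 0%:E * dist I v (~` setT)); last by rewrite mul0e adde0.
apply: integral_le_set => //; first by move=> x; exact: iexp_ge0.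
by move=> x; rewrite addr0.
Qed.

Context (M : V -> set R) (delta : R).
Hypothesis mM : forall v, measurable (M v).
Hypothesis PM : forall v, (1 - delta)%:E <= dist I v (M v).

(** Each integration costs a factor [1 - delta]; as in Bernoulli's inequality, the losses at most
    add up. *)
Lemma iexp_ge_box s f w (K : R) : uniq s -> (0 <= K)%R ->
  (0 <= delta <= 1)%R ->
  (forall w, 0 <= f w) ->
  (forall w', (forall v, v \in s -> M v (w' v)) ->
    (forall v, v \notin s -> w' v = w v) -> K%:E <= f w') ->
  (K * (1 - (size s)%:R * delta))%:E <= iexp I s f w.
Proof.
move=> + K0 /andP[d0 d1] f0; elim: s w => /= [w _ fK|v s IH w /andP[vs us] fK].
  by rewrite mul0r subr0 mulr1; exact: fK.
set L := (1 - (size s)%:R * delta)%R in IH *.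
(* Monotonicity of the product needs [0 <= L]; for negative [L] the claimed bound is nonpositive. *)
have [L0|L0] := leP 0%R L; last first.
  apply: (@le_trans _ _ 0); last first.
    by apply: integral_ge0 => x _; exact: iexp_ge0.
  rewrite lee_fin; apply: mulr_ge0_le0 => //.
  by rewrite -natr1; move: L0; rewrite /L; lra.
apply: (@le_trans _ _ ((K * L)%:E * dist I v (M v))).
  apply: (@le_trans _ _ ((K * L)%:E * (1 - delta)%:E)).
    rewrite -EFinM lee_fin -mulrA ler_wpM2l// -natr1.
    have nd : (0 <= (size s)%:R * delta)%R by rewrite mulr_ge0.
    rewrite /L; nra.
  by apply: lee_wpmul2l => //; rewrite lee_fin mulr_ge0.
apply: integral_ge_set => //; first by rewrite mulr_ge0.
  by move=> x; exact: iexp_ge0.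
move=> x Mx; apply: IH => // w' w'M w'E; apply: fK => u.
  rewrite inE => /predU1P[->|/w'M//].
  by rewrite w'E// eqxx.
by rewrite inE negb_or => /andP[uv /w'E ->]; rewrite (negbTE uv).
Qed.

(** Union bound: the box is missed with probability at most [size s] times [delta], and there [f]
    exceeds [K] by at most [C]. *)
Lemma iexp_le_box s f w (K C : R) : uniq s -> (0 <= K)%R -> (0 <= C)%R ->
  (0 <= delta)%R ->
  (forall w, 0 <= f w) -> (forall w, f w <= (K + C)%:E) ->
  (forall w', (forall v, v \in s -> M v (w' v)) ->
    (forall v, v \notin s -> w' v = w v) -> f w' <= K%:E) ->
  iexp I s f w <= (K + C * ((size s)%:R * delta))%:E.
Proof.
move=> + K0 C0 d0 f0 fKC; elim: s w => /= [w _ fK|v s IH w /andP[vs us] fK].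
  by rewrite mul0r mulr0 addr0; exact: fK.
have nd : (0 <= (size s)%:R * delta)%R by rewrite mulr_ge0.
have Cnd : (0 <= C * ((size s)%:R * delta))%R by rewrite mulr_ge0.
apply: (@le_trans _ _ ((K + C * ((size s)%:R * delta))%:E + C%:E * dist I v (~` M v))).
  apply: integral_le_set => //; first by rewrite addr_ge0.
  - by move=> x; exact: iexp_ge0.
  - move=> x; apply: (le_trans (iexp_le_cst _ _ f0 fKC)).
    by rewrite lee_fin; lra.
  - move=> x Mx; apply: IH => // w' w'M w'E; apply: fK => u.
      rewrite inE => /predU1P[->|/w'M//].
      by rewrite w'E// eqxx.
    by rewrite inE negb_or => /andP[uv /w'E ->]; rewrite (negbTE uv).
rewrite -natr1 mulrDl mul1r mulrDr addrA [leRHS]EFinD leeD2l//.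
rewrite EFinM lee_wpmul2l// ?lee_fin//.
rewrite probability_setC// leeBlDl ?fin_num_measure//.
by have := PM v; rewrite -leeBlDr// -EFinB.
Qed.

End iterated_integral.

(** * Uniform laws on intervals *)

Section uniform.
Context {R : realType}.
Implicit Types a b : R.

Lemma measurable_oitv a b : measurable (oitv a b).
Proof.
by rewrite (_ : oitv a b = `]a, b[%classic).
Qed.

(* [uniform_prob] lives on the generated sigma-algebra [measurableTypeR R]; the
   canonical measurable structure of [R] has the same measurable sets. *)
Definition uniformR a b (ab : a < b) : set R -> \bar R := uniform_prob ab.

HB.instance Definition _ a b (ab : a < b) :=
  isMeasure.Build default_measure_display R R (uniformR ab)
    (measure0 (uniform_prob ab)) (measure_ge0 (uniform_prob ab))
    (@measure_semi_sigma_additive _ _ _ (uniform_prob ab)).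

HB.instance Definition _ a b (ab : a < b) :=
  Measure_isProbability.Build _ _ _ (uniformR ab)
    (probability_setT (uniform_prob ab)).

Lemma uniformR_oitv a b (ab : a < b) c d : a <= c -> c < d -> d <= b ->
  uniformR ab (oitv c d) = ((d - c) / (b - a))%:E.
Proof.
move=> ac cd db; rewrite /uniformR /uniform_prob.
rewrite (eq_integral (fun=> ((b - a)^-1)%:E)); last first.
  move=> x; rewrite inE /oitv/= => /andP[cx xd]; rewrite /uniform_pdf ifT//.
  by rewrite (le_trans ac (ltW cx)) (le_trans (ltW xd)).
rewrite integral_cst//=; last exact: measurable_oitv.
by rewrite (_ : oitv c d = `]c, d[%classic)// lebesgue_measure_itv/= lte_fin cd -EFinD -EFinM mulrC.
Qed.

Lemma uniformR_oitv1 a b (ab : a < b) c d : c <= a -> b <= d ->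
  uniformR ab (oitv c d) = 1%E.
Proof.
move=> ca bd; apply/eqP; rewrite eq_le probability_le1/=; last exact: measurable_oitv.
apply: (@le_trans _ _ (uniformR ab (oitv a b))).
  by rewrite uniformR_oitv// divff// gt_eqF// subr_gt0.
apply: le_measure; rewrite ?inE; [exact: measurable_oitv..|].
by move=> x /andP[ax xb]; rewrite /oitv/= (le_lt_trans ca)//= (lt_le_trans xb).
Qed.

Lemma uniformR_oitv_gt0 a b (ab : a < b) c d :
  Num.max a c < Num.min b d -> (0 < uniformR ab (oitv c d))%E.
Proof.
move=> cd; apply: (@lt_le_trans _ _
    (uniformR ab (oitv (Num.max a c) (Num.min b d)))).
  rewrite uniformR_oitv// ?le_max ?lexx// ?ge_min ?lexx//.
  by rewrite lte_fin divr_gt0// subr_gt0.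
apply: le_measure; rewrite ?inE; [exact: measurable_oitv..|].
by move=> x; rewrite /oitv/= gt_max lt_min => /andP[/andP[_ ->] /andP[_ ->]].
Qed.

Lemma uniformR_set1 a b (ab : a < b) x : uniformR ab [set x] = 0%E.
Proof. by rewrite /uniformR /uniform_prob integral_set1. Qed.

End uniform.

(** * Mixtures of two probability measures *)

Section mixture.
Context {d} {T : measurableType d} {R : realType}.
Import HBNNSimple.
Context (p : R) (p0 : 0 <= p) (p1 : p <= 1) (P Q : probability T R).

Let q0 : 0 <= 1 - p. Proof. by rewrite subr_ge0. Qed.

Definition mixture : set T -> \bar R :=
  measure_add (mscale (NngNum q0) P) (mscale (NngNum p0) Q).

HB.instance Definition _ := Measure.on mixture.

Lemma mixtureE A : mixture A = ((1 - p)%:E * P A + p%:E * Q A)%E.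
Proof. by rewrite /mixture measure_addE. Qed.

Let mixture_setT : mixture setT = 1%E.
Proof. by rewrite mixtureE !probability_setT !mule1 -EFinD subrK. Qed.

HB.instance Definition _ := Measure_isProbability.Build _ _ _ mixture mixture_setT.

Lemma mixture_gt0l A : p < 1 -> (0 < P A)%E -> (0 < mixture A)%E.
Proof.
move=> pl1 PA; rewrite mixtureE; apply: (@lt_le_trans _ _ ((1 - p)%:E * P A)%E).
  by rewrite mule_gt0// lte_fin subr_gt0.
by rewrite leeDl// mule_ge0.
Qed.

Lemma mixture_gt0r A : 0 < p -> (0 < Q A)%E -> (0 < mixture A)%E.
Proof.
move=> p_gt0 QA; rewrite mixtureE; apply: (@lt_le_trans _ _ (p%:E * Q A)%E).
  by rewrite mule_gt0// lte_fin.
by rewrite leeDr// mule_ge0// lee_fin.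
Qed.

End mixture.

Local Close Scope classical_set_scope.

(** * Feasible query sets, runs of an algorithm and the optimum *)

Section queries.
Context {R : realType} {V : finType} (I : instance R V).
Implicit Types (Q F : {set V}) (w : V -> R).

(** Queries are never undone, so cover vertices that turn out useless remain paid for. *)
Lemma phase2_superset (A : vc_algorithm) w n Q cur :
  Q \subset phase2 I A w n Q cur.
Proof.
elim: n Q cur => [|n IH] Q [F|] //=.
  case: ifP => _; first exact: IH.
  by apply: fintype.subset_trans (IH _ _); exact: finset.subsetUr.
by case: next_edge => [F|//]; exact: IH.
Qed.

(* A newly selected hyperedge is still unresolved, so at least one vertex is
   queried between two selections and each query accounts for at most three
   steps of the run. *)
Lemma phase2_feasible (A : vc_algorithm) w n Q cur : valid_algorithm I A ->
  match cur with
  | None => (3 * #|~: Q| < n)%N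
  | Some F => F \in hedges I /\
      if `[< known_min I Q w F >] then (3 * #|~: Q| + 2 <= n)%N
      else (3 * #|~: Q| <= n)%N
  end ->
  feasible I w (phase2 I A w n Q cur).
Proof.
move=> [_ _ nextP vertexP].
have step Q' F : F \in hedges I -> ~ known_min I Q' w F ->
    #|~: Q'| = #|~: (next_vertex A Q' w F |: Q')%SET|.+1.
  move=> FI /(vertexP _ _ _ FI)[_ vQ _].
  rewrite (cardsD1 (next_vertex A Q' w F)) inE vQ add1n; congr (#|pred_of_set _|.+1).
  by apply/setP => u; rewrite !inE negb_or.
elim: n Q cur => [|n IH] Q [F|] /=.
(* Without fuel the invariant is contradictory: an unresolved [F] still has an unqueried vertex. *)
- move=> [FI]; case: asboolP => [_|kF]; first by rewrite addn2.
  by rewrite (step _ _ FI kF).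
- by [].
- move=> [FI]; case: asboolP => [_ ?|kF hn]; first by apply: IH => /=; lia.
  apply: IH; split => //; move: hn; rewrite (step _ _ FI kF).
  by case: ifP => _; lia.
- move=> hn; have := nextP Q w; case: next_edge => [F [FI kF]|//].
  by apply: IH; split => //; case: asboolP => // _; lia.
Qed.

Lemma alg_queries_feasible (A : vc_algorithm) w :
  valid_algorithm I A -> feasible I w (alg_queries I A w).
Proof.
move=> vA; apply: phase2_feasible => //.
have : (#|~: vc A| <= #|V|)%N by exact: max_card.
lia.
Qed.

(** Raising [v] to [hi] refutes the candidate [v]; lowering it to [lo] refutes every other
    candidate. *)
Lemma not_known_min Q w F v (z : V -> R) lo hi :
  v \in F -> v \notin Q ->
  consistent I Q w z ->
  lft I v < lo < rgt I v -> lft I v < hi < rgt I v ->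
  (forall u, u \in F -> u != v -> lo < z u) ->
  (exists2 u, u \in F & u != v /\ z u < hi) ->
  ~ known_min I Q w F.
Proof.
move=> vF vQ zc lov hiv loz [u uF [uv zu]] [m mF km].
have upd x : lft I v < x < rgt I v ->
    consistent I Q w (fun t => if t == v then x else z t).
  move=> xv t; case: eqP => [->|_]; last exact: zc.
  by split => // vQ'; rewrite vQ' in vQ.
have [mv|mv] := eqVneq m v.
  have := km _ (upd _ hiv) _ uF; rewrite mv eqxx (negbTE uv) leNgt.
  by rewrite zu.
have := km _ (upd _ lov) _ vF; rewrite eqxx (negbTE mv) leNgt.
by rewrite loz.
Qed.

Lemma OPT_le w Q : feasible I w Q -> OPT I w <= qcost I Q.
Proof. by move=> fQ; apply: bigmin_le_cond; exact/asboolP. Qed.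

Lemma OPT_le_setT w : OPT I w <= qcost I [set: V]%SET.
Proof. exact: bigmin_le_id. Qed.

(** The whole vertex set is the default value of the minimum, hence the first hypothesis. *)
Lemma OPT_ge w K : K <= qcost I [set: V]%SET ->
  (forall Q, feasible I w Q -> K <= qcost I Q) -> K <= OPT I w.
Proof. by move=> KT KQ; apply: le_bigmin => // Q /asboolP; exact: KQ. Qed.

Lemma OPT_ge0 w : (forall v, 0 <= cost I v) -> 0 <= OPT I w.
Proof. by move=> c0; apply: OPT_ge => [|Q _]; exact: sumr_ge0. Qed.

End queries.

(** * The gadget and its typical realizations *)

Section gadget.
Context {R : realType} (graph : bool) (n : nat) (c delta : R).
Context (c_ge0 : 0 <= c) (delta_gt0 : 0 < delta) (delta_lt1 : delta < 1).

(* The hub is [None]. Each weight is a mixture of a uniform law on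
   ([alo v], [ahi v]) and one on ([blo v], [bhi v]), the latter with weight
   [bweight v]; for a leaf the second interval is all of I_v. *)
Definition vtx := option ('I_n.+1 * bool).
Definition va i : vtx := Some (i, false).
Definition vb i : vtx := Some (i, true).

Definition glft (v : vtx) : R :=
  match v with None => 1 | Some (_, b) => if b then 2 else 0 end.
Definition grgt (v : vtx) : R :=
  match v with None => 5 | Some (_, b) => if b then 6 else 4 end.
Definition alo (v : vtx) : R :=
  match v with
  | None => 1
  | Some (_, b) => if b then 4 else if graph then 0 else 3
  end.
Definition ahi (v : vtx) : R :=
  match v with
  | None => 2
  | Some (_, b) => if b then 6 else if graph then 1 else 4
  end.
Definition blo (v : vtx) : R := if v is None then 4 else glft v.
Definition bhi (v : vtx) : R := grgt v.
Definition bweight (v : vtx) : R := if v is None then 1/2 else delta.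

Lemma a_lt v : alo v < ahi v.
Proof. by case: v => [[i []]|]; rewrite /alo/ahi; try case: graph; lra. Qed.
Lemma b_lt v : blo v < bhi v.
Proof. by case: v => [[i []]|]; rewrite /blo/bhi/=; lra. Qed.
Lemma bweight_gt0 v : 0 < bweight v.
Proof. by case: v => //=; lra. Qed.
Lemma bweight_lt1 v : bweight v < 1.
Proof. by case: v => //=; lra. Qed.

Definition gdist (v : vtx) : probability R R :=
  mixture (ltW (bweight_gt0 v)) (ltW (bweight_lt1 v))
    (uniformR (a_lt v)) (uniformR (b_lt v)).

Definition ghedges : {set {set vtx}} :=
  [set F | [exists i,
    if graph then [|| F == [set None; va i]%SET, F == [set None; vb i]%SET
                    | F == [set va i; vb i]%SET]
    else F == [set None; va i; vb i]%SET]]%SET.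

Definition ginst : instance R vtx :=
  Instance ghedges (fun v => if v is None then c else 1) gdist glft grgt.

Lemma ginst_wf : wf_instance ginst.
Proof.
split => /=.
- move=> F; rewrite inE => /existsP[i]; case: graph.
    by move=> /or3P[]/eqP->; apply/card_gt0P;
       [exists None|exists None|exists (va i)]; rewrite !inE eqxx.
  by move=> /eqP->; apply/card_gt0P; exists None; rewrite !inE eqxx.
- by case.
- by case=> [[i []]|]; rewrite /=; lra.
- move=> v x; rewrite /gdist/= mixtureE /= !uniformR_set1.
  by rewrite !mule0 adde0.
- split.
  + rewrite /gdist/= mixtureE /= !uniformR_oitv1 ?mule1 -?EFinD ?subrK//;
    case: v => [[i []]|]; rewrite /alo/ahi/blo/bhi/=; try case: graph; lra.
  + move=> {}v e e0; rewrite /gdist/=.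
    (* The [delta] component of a leaf fills its interval and charges both ends; the two components
       of the hub charge one end each. *)
    case: v => [[i b]|]; split.
    * apply: mixture_gt0r; first exact: bweight_gt0.
      apply: uniformR_oitv_gt0.
      by rewrite /blo/bhi gt_max !lt_min; case: b => /=; lra.
    * apply: mixture_gt0r; first exact: bweight_gt0.
      apply: uniformR_oitv_gt0.
      by rewrite /blo/bhi gt_max !lt_min; case: b => /=; lra.
    * apply: mixture_gt0l; first exact: bweight_lt1.
      apply: uniformR_oitv_gt0.
      by rewrite gt_max !lt_min /=; lra.
    * apply: mixture_gt0r; first exact: bweight_gt0.
      apply: uniformR_oitv_gt0.
      by rewrite gt_max !lt_min /=; lra.
Qed.

(* The weight of the hub decides which side is expensive: in a [typical b]
   realization all vertices [(i, b)] are mandatory, and together with the hub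
   they are sufficient. *)
Definition typical (b : bool) (w : vtx -> R) : Prop :=
  (if b then 4 < w None < 5 else 1 < w None < 2) /\
  forall i b', alo (Some (i, b')) < w (Some (i, b')) < ahi (Some (i, b')).

(** An unqueried [(i, b)] may still lie on either side of the hub's weight, which leaves a common
    hyperedge unresolved. *)
Lemma mandatory b w Q i : typical b w -> feasible ginst w Q -> Some (i, b) \in Q.
Proof.
move=> [wx wab] fQ; apply: contrapT => /negP iQ.
have [F FI [xF iF Fsub]] : exists2 F, F \in hedges ginst &
    [/\ None \in F, Some (i, b) \in F &
      forall u, u \in F -> u != Some (i, b) ->
        u = None \/ (graph = false /\ u = Some (i, ~~ b))].
  (* The graph edge omits the other leaf: a typical [va i] in (0,1) is below all of (2,6) and would
     settle the minimum. *)
  exists (if graph then [set None; Some (i, b)] else [set None; va i; vb i])%SET.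
    rewrite inE; apply/existsP; exists i; case: graph; last by rewrite eqxx.
    by case: b {wx iQ}; rewrite eqxx ?orbT.
  split; [by case: graph; rewrite !inE eqxx|by case: graph b {wx iQ} => [] []; rewrite !inE eqxx ?orbT|].
  move=> u; case: graph; rewrite !inE; last first.
    by case: b {wx iQ} => /orP[/orP[]|] /eqP ->; rewrite ?eqxx//; auto.
  by move=> /orP[/eqP|/eqP] ->; rewrite ?eqxx//; auto.
have wxb : glft None < w None < grgt None by case: b {iQ iF Fsub} wx => /=; lra.
(* Hidden weights are set to midpoints: of the hub's range, of (4,6) and of (3,4). The last is
   typical only for hyperedges, but in the graph case [F] has no second leaf. *)
pose z (u : vtx) : R := if u \in Q then w u else
  match u with
  | None => if b then 9/2 else 3/2
  | Some (_, b') => if b' then 5 else 7/2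
  end.
have zc : consistent ginst Q w z.
  move=> u; rewrite /z; split => [->//|/negbTE ->].
  by case: u => [[j []]|] /=; try case: (b); lra.
have zx : if b then 4 < z None < 5 else 1 < z None < 2.
  by rewrite /z; case: (None \in Q) => //; case: (b); rewrite /=; lra.
have zo : graph = false ->
    alo (Some (i, ~~ b)) < z (Some (i, ~~ b)) < ahi (Some (i, ~~ b)).
  move=> gF; rewrite /z; case: (_ \in Q) => //.
  by rewrite /alo/ahi gF; case: (b); rewrite /=; lra.
(* The low values 1/2 and 5/2 undercut the hub and, for hyperedges, the other leaf; the high values
   3 and 11/2 exceed the hub. *)
clearbody z; apply: (@not_known_min _ _ ginst Q w F (Some (i, b)) z
  (if b then 5/2 else 1/2) (if b then 11/2 else 3)) (fQ _ FI) => //.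
- by case: (b) => /=; lra.
- by case: (b) => /=; lra.
- move=> u uF /(Fsub _ uF)[->|[gF ->]].
    by move: zx; case: (b) => zx; lra.
  by move: zo; rewrite /alo/ahi gF; case: (b) => /= /(_ erefl) zo; lra.
- by exists None => //; split => //; move: zx; case: (b) => zx; lra.
Qed.

Definition side_cover (b : bool) : {set vtx} :=
  [set v | if v is Some (_, b') then b' == b else true]%SET.

(** On side [true] the known hub and [vb i] exceed 4, an upper bound for the hidden [va i]. On side
    [false] every hyperedge has a known weight below 2, a lower bound for the hidden [vb i]. *)
Lemma side_cover_feasible b w : typical b w -> feasible ginst w (side_cover b).
Proof.
move=> [wx wab] F; rewrite inE => /existsP[i].
have wa := wab i false; have wb := wab i true.
have known w' : consistent ginst (side_cover b) w w' ->
    [/\ w' None = w None, w' (Some (i, b)) = w (Some (i, b)),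
        0 < w' (va i) < 4 & 2 < w' (vb i) < 6].
  move=> cw; split; [by apply: (cw None).1; rewrite inE|
    by apply: (cw (Some (i, b))).1; rewrite inE eqxx| |].
  - have [aQ|/(cw (va i)).2//] := boolP (va i \in side_cover b).
    rewrite (cw (va i)).1//; move: wa; rewrite /alo/ahi.
    by case: graph; rewrite -/(va i); lra.
  - have [bQ|/(cw (vb i)).2//] := boolP (vb i \in side_cover b).
    by rewrite (cw (vb i)).1//; move: wb; rewrite /alo/ahi -/(vb i); lra.
have inE2 (s t : vtx) u : u \in [set s; t]%SET -> u = s \/ u = t.
  by rewrite !inE => /orP[]/eqP; auto.
rewrite /alo/ahi -/(va i) -/(vb i) in wa wb.
case: graph wa wb => wa wb.
- move=> /or3P[]/eqP->.
  + exists (va i); first by rewrite !inE eqxx orbT.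
    move=> w' /known[kx kb ka _] u /inE2[]->//; rewrite kx.
    move: wa ka kb wx.
    case: (b) => //= wa0 ka kb wx0; first by lra.
    by rewrite -/(va i) in kb; rewrite kb; lra.
  (* On side [true] both weights are known and may come in either order. *)
  + exists (if b && (w (vb i) < w None) then vb i else None).
      by case: ifP => _; rewrite !inE eqxx ?orbT.
    move=> w' /known[kx kb _ kb'] u /inE2[]->; rewrite ?kx.
      case: (b) wx kb => /= wx kb; last by rewrite kx.
      by rewrite -/(vb i) in kb; case: ltP => // ?; rewrite ?kx ?kb// ltW.
    case: (b) wx kb => /= wx kb; last by rewrite kx; lra.
    by rewrite -/(vb i) in kb; case: ltP => // ?; rewrite ?kx ?kb.
  + exists (va i); first by rewrite !inE eqxx.
    move=> w' /known[kx kb ka kb'] u /inE2[]->//.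
    move: kb.
    case: (b) wx {kx} => /= wx; rewrite -?/(va i) -?/(vb i) => kb; lra.
(* A known [va i] in (3,4) is above a small hub; a hidden one is below a large hub by its
   interval. *)
- move=> /eqP ->; exists (if b then va i else None).
    by case: (b); rewrite !inE eqxx ?orbT.
  move=> w' /known[kx kb ka kb'] u; rewrite !inE => uF.
  move: kb.
  case: (b) wx kx => /= wx kx; rewrite -?/(va i) -?/(vb i) => kb.
    by move: uF => /orP[/orP[]|] /eqP ->//; lra.
  by move: uF => /orP[/orP[]|] /eqP ->//; lra.
Qed.

(** * Query costs on typical realizations *)

Definition nside (b : bool) (Q : {set vtx}) : nat := #|[set i | Some (i, b) \in Q]%SET|.

Lemma nside_le b Q : (nside b Q <= n.+1)%N.
Proof. by have := max_card (mem [set i | Some (i, b) \in Q]%SET); rewrite card_ord. Qed.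

Lemma big_vtx (f : vtx -> R) :
  \sum_v f v = f None + (\sum_i f (va i) + \sum_i f (vb i)).
Proof.
rewrite (bigD1 None)//= (reindex_omap Some id); last by case.
congr (_ + _); rewrite (eq_bigl xpredT) => [|p]; last by rewrite /= eqxx.
rewrite -big_split/=.
rewrite (eq_bigr (fun i => \sum_b f (Some (i, b)))); last first.
  by move=> i _; rewrite big_bool addrC.
by rewrite pair_bigA/=; apply: eq_bigr => -[].
Qed.

Lemma qcostE Q : qcost ginst Q =
  (if None \in Q then c else 0) + (nside false Q + nside true Q)%:R.
Proof.
rewrite /qcost big_mkcond/= big_vtx natrD; congr (_ + (_ + _));
by rewrite -big_mkcond/= /nside -sum1_card natr_sum; apply: eq_bigl => i; rewrite !inE.
Qed.

Lemma card_vtx : #|{: vtx}| = (2 * n.+1).+1.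
Proof. by rewrite card_option card_prod card_ord card_bool mulnC. Qed.

(** Each pair [va i], [vb i] is an edge of the vertex cover instance: [va i] has the least left
    endpoint, 0, and (0,4) meets (2,6). *)
Lemma vertex_cover_nside C : vertex_cover ginst C ->
  (n.+1 <= nside false C + nside true C)%N.
Proof.
move=> vC.
have -> : n.+1 = #|([set i | Some (i, false) \in C] :|: [set i | Some (i, true) \in C])%SET|.
  rewrite -[LHS]card_ord -cardsT; congr #|pred_of_set _|.
  apply/setP => i; rewrite !inE; apply/esym/vC.
  rewrite /barE; apply/andP; split; first by apply/eqP => -[].
  apply/existsP.
  exists (if graph then [set va i; vb i] else [set None; va i; vb i])%SET.
  apply/andP; split.
    rewrite inE; apply/existsP; exists i.
    by case: graph; rewrite eqxx ?orbT.
  apply/and4P; split.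
  - by case: graph; rewrite !inE eqxx ?orbT.
  - by case: graph; rewrite !inE eqxx ?orbT.
  - apply/orP; left; apply/andP; split.
      by case: graph; rewrite !inE eqxx ?orbT.
    by apply/forall_inP => -[[j []]|] _ /=; lra.
  - by rewrite gt_max !lt_min/=; lra.
exact: leq_card_setU.
Qed.

Lemma typical_OPT_le b w : typical b w -> OPT ginst w <= n.+1%:R + c.
Proof.
move=> /side_cover_feasible/OPT_le/le_trans; apply; rewrite qcostE inE addrC lerD2r ler_nat.
have nb0 : nside (~~ b) (side_cover b) = 0%N.
  by apply: eq_card0 => i; rewrite !inE; case: (b).
have := nside_le b (side_cover b).
by case: (b) nb0 => /= ->; rewrite ?addn0 ?add0n.
Qed.

Lemma typical_OPT_ge b w : typical b w -> n.+1%:R <= OPT ginst w.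
Proof.
have full (Q : {set vtx}) : (forall i, Some (i, b) \in Q) -> n.+1%:R <= qcost ginst Q.
  move=> bQ; rewrite qcostE.
  have nb : nside b Q = n.+1.
    by rewrite -[RHS]card_ord; apply: eq_card => i; rewrite !inE bQ.
  apply: (@le_trans _ _ (nside false Q + nside true Q)%:R).
    by rewrite ler_nat; case: b nb {bQ} => nb; lia.
  by rewrite lerDr; case: ifP.
move=> tw; apply: OPT_ge => [|Q fQ]; apply: full => i; first by rewrite inE.
exact: mandatory tw fQ.
Qed.

(** The final query set contains all of the mandatory side, by feasibility, and the part of the
    cover on the other side. *)
Lemma typical_alg_ge (A : vc_algorithm) b w : valid_algorithm ginst A ->
  typical b w -> (n.+1 + nside (~~ b) (vc A))%:R <= alg_cost ginst A w.
Proof.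
move=> vA tw; rewrite /alg_cost; set Q := alg_queries _ _ _.
have nb : nside b Q = n.+1.
  rewrite -[RHS]card_ord; apply: eq_card => i; rewrite !inE.
  exact: mandatory tw (alg_queries_feasible w vA).
have nbA : (nside (~~ b) (vc A) <= nside (~~ b) Q)%N.
  apply: subset_leq_card; apply/fintype.subsetP => i; rewrite !inE.
  exact: (fintype.subsetP (phase2_superset _ _ _ _ _ _)).
rewrite qcostE; apply: (@le_trans _ _ (nside false Q + nside true Q)%:R).
  by rewrite ler_nat; case: b nb nbA {tw} => /= nb nbA; lia.
by rewrite lerDr; case: ifP.
Qed.

(** * Expectations of the optimum and of an algorithm *)

Lemma gdist_a v : ((1 - bweight v)%:E <= gdist v (oitv (alo v) (ahi v)))%E.
Proof.
rewrite /gdist/= mixtureE/= uniformR_oitv1// mule1 leeDl// mule_ge0//.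
by rewrite lee_fin ltW// bweight_gt0.
Qed.

Lemma gdist_b v : ((bweight v)%:E <= gdist v (oitv (blo v) (bhi v)))%E.
Proof.
rewrite /gdist/= mixtureE/= (@uniformR_oitv1 _ (blo v))// mule1 leeDr// mule_ge0//.
by rewrite lee_fin subr_ge0 ltW// bweight_lt1.
Qed.

(** The box bounds need one set per vertex, so the hub may take either side here. *)
Definition typical_values (v : vtx) : set R :=
  if v is None then (oitv 1 2 `|` oitv 4 5)%classic else oitv (alo v) (ahi v).

Lemma measurable_typical_values v : measurable (typical_values v).
Proof.
case: v => [p|]; first exact: measurable_oitv.
by apply: measurableU; exact: measurable_oitv.
Qed.

Lemma disjoint_hub_values : (oitv (1 : R) 2 `&` oitv 4 5 = set0)%classic.
Proof. by apply/seteqP; split => // x []; rewrite /oitv/= => x1 x2; lra. Qed.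

Lemma gdist_typical_values v : ((1 - delta)%:E <= gdist v (typical_values v))%E.
Proof.
case: v => [p|]; first exact: gdist_a.
rewrite /typical_values measureU ?disjoint_hub_values//; last 2 first.
- exact: measurable_oitv.
- exact: measurable_oitv.
apply: (@le_trans _ _ ((1 - bweight None)%:E + (bweight None)%:E)%E).
  by rewrite -EFinD lee_fin subrK gerBl ltW.
exact: (leeD (gdist_a None) (gdist_b None)).
Qed.

Lemma typical_of_values w : (forall v, typical_values v (w v)) ->
  exists b, typical b w.
Proof.
move=> tw; case: (tw None) => wx; [exists false|exists true]; split => // i b'.
- exact: (tw (Some (i, b'))).
- exact: (tw (Some (i, b'))).
Qed.

Let leaves : seq vtx := [seq Some p | p <- enum {: 'I_n.+1 * bool}].

(** The hub comes first, so its integral is the outermost one and can be split by side. *)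
Let enum_vtx : enum {: vtx} = None :: leaves.
Proof. by rewrite /leaves !enumT [in LHS]unlock. Qed.

Let size_leaves : size leaves = (2 * n.+1)%N.
Proof. by rewrite size_map -cardE card_prod card_ord card_bool mulnC. Qed.

(** Each side of the hub has mass at least 1/2; given the side, the box bound applies to the
    leaves. *)
Lemma expect_ge_typical (f : (vtx -> R) -> \bar R) (K : bool -> R) :
  (2 * n.+1)%:R * delta <= 1 ->
  (forall w, (0 <= f w)%E) -> (forall b, 0 <= K b) ->
  (forall b w, typical b w -> ((K b)%:E <= f w)%E) ->
  (((K false + K true) / 2 * (1 - (2 * n.+1)%:R * delta))%:E <= expect ginst f)%E.
Proof.
move=> nd f0 K0 fK; rewrite /expect enum_vtx /=.
set L := 1 - (2 * n.+1)%:R * delta.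
have L0 : 0 <= L by rewrite subr_ge0.
have inner b x w : (if b then 4 < x < 5 else 1 < x < 2) ->
    ((K b * L)%:E <= iexp ginst leaves f (fun u => if u == None then x else w u))%E.
  move=> xb; rewrite /L -size_leaves.
  apply: (@iexp_ge_box _ _ ginst typical_values delta) => //.
  - exact: measurable_typical_values.
  - exact: gdist_typical_values.
  - by rewrite map_inj_uniq ?enum_uniq// => p q [].
  - by rewrite !ltW.
  move=> w' tw wE; apply: fK; split.
    rewrite wE ?eqxx//; apply/negP => /mapP[]//.
  by move=> i b'; apply: (tw (Some (i, b'))); apply/mapP; exists (i, b'); rewrite ?mem_enum.
apply: (@le_trans _ _ ((K false * L)%:E * gdist None (oitv 1 2) +
                       (K true * L)%:E * gdist None (oitv 4 5))%E).
  apply: (@le_trans _ _ ((K false * L)%:E * (1 - bweight None)%:E +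
                         (K true * L)%:E * (bweight None)%:E)%E).
    by rewrite -!EFinM -EFinD lee_fin /bweight; lra.
  apply: leeD; apply: lee_wpmul2l; rewrite ?lee_fin ?mulr_ge0//.
    exact: (gdist_a None).
  exact: (gdist_b None).
apply: integral_ge_two_sets.
- exact: measurable_oitv.
- exact: measurable_oitv.
- exact: disjoint_hub_values.
- by rewrite mulr_ge0.
- by rewrite mulr_ge0.
- by move=> x; exact: iexp_ge0.
- by move=> x; exact: (inner false).
- by move=> x; exact: (inner true).
Qed.

(** Of the slack [eta * n.+1], the hub uses at most half, by the first hypothesis, and atypical
    realizations at most a quarter, by the second. *)
Lemma ginst_vc_lower_bound (eta : R) : 3 * c <= eta * n.+1%:R ->
  12 * ((2 * n.+1).+1%:R * delta) <= eta -> (2 * n.+1).+1%:R * delta < 1 ->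
  vc_lower_bound ginst eta.
Proof.
move=> hc hd hd1.
have d0 := delta_gt0.
have cost0 v : 0 <= cost ginst v by case: v.
have OPT0 w : (0 <= (OPT ginst w)%:E)%E by rewrite lee_fin OPT_ge0.
set N : R := n.+1%:R in hc *.
have N0 : 0 < N by rewrite ltr0n.
set th := (2 * n.+1).+1%:R * delta in hd hd1 *.
(* [th] counts all vertices; the lower bounds lose mass on the leaves only. *)
have thE : (2 * n.+1)%:R * delta = th - delta.
  by rewrite /th -natr1 mulrDl mul1r addrK.
have lowO : ((N * (1 - (th - delta)))%:E <= E_OPT ginst)%E.
  rewrite -thE (_ : N = (N + N) / 2); last by lra.
  apply: (@expect_ge_typical _ (fun=> N)) => //.
  - by rewrite thE; lra.
  - by move=> b w tw; rewrite lee_fin (typical_OPT_ge tw).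
have upO : (E_OPT ginst <= (N + c + N * th)%:E)%E.
  rewrite /th -card_vtx cardE.
  apply: (@iexp_le_box _ _ ginst typical_values delta) => //.
  - exact: measurable_typical_values.
  - exact: gdist_typical_values.
  - exact: enum_uniq.
  - by rewrite addr_ge0// ltW.
  - exact: ltW.
  (* Querying everything costs [2 * N + c], an excess of [N] over the typical bound. *)
  - move=> w; rewrite lee_fin; apply: (le_trans (OPT_le_setT _ _)).
    rewrite qcostE inE addrC addrAC lerD2r /N -natrD ler_nat leq_add//; exact: nside_le.
  - move=> w tw _; rewrite lee_fin.
    have [v|b tb] := @typical_of_values w; first by apply: tw; rewrite mem_enum.
    exact: typical_OPT_le tb.
split; first by apply: lt_le_trans lowO; rewrite lte_fin mulr_gt0//; lra.
move=> A vA.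
have upA : ((3 / 2 * N * (1 - (th - delta)))%:E <= E_alg ginst A)%E.
  pose K b : R := (n.+1 + nside (~~ b) (vc A))%:R.
  (* Averaging over the sides charges half of the cover's leaves, at least [N / 2], on top of
     [N]. *)
  apply: (@le_trans _ _ ((K false + K true) / 2 * (1 - (th - delta)))%:E).
    rewrite lee_fin ler_wpM2r//; first by lra.
    have [vcov _ _ _] := vA.
    have := vertex_cover_nside vcov; rewrite -(ler_nat R) natrD -/N => cov.
    by rewrite /K /= !natrD -/N; lra.
  rewrite -thE; apply: expect_ge_typical => //.
  - by rewrite thE; lra.
  - by move=> w; rewrite lee_fin; apply: sumr_ge0.
  - by move=> b w tw; rewrite lee_fin; exact: typical_alg_ge.
apply: le_trans upA; move: lowO upO.
case: (E_OPT ginst) => [e| |]//; rewrite !lee_fin => lowO upO.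
have e0 : 0 <= e by apply: le_trans lowO; rewrite mulr_ge0//; lra.
have Ntd : 0 <= N * delta by rewrite mulr_ge0// ltW.
(* The upper bound on [E_OPT] can be multiplied only by a nonnegative factor; otherwise signs
   suffice. *)
have [eta_big|eta_small] := leP (3 / 2) eta.
  apply: (@le_trans _ _ 0).
    by rewrite mulr_le0_ge0//; lra.
  by rewrite !mulr_ge0//; lra.
apply: (@le_trans _ _ ((3 / 2 - eta) * (N + c + N * th))).
  by rewrite ler_wpM2l//; lra.
have h1 : 12 * (N * th) <= eta * N.
  by rewrite mulrCA mulrC ler_wpM2r// ltW.
have h2 : 0 <= eta * (c + N * th).
  apply: mulr_ge0; first by apply: le_trans hd; rewrite !mulr_ge0// ltW.
  by rewrite addr_ge0// mulr_ge0 ?ltW// mulr_gt0.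
lra.
Qed.

End gadget.

(** * Membership in the classes of instances *)

Section gadget_classes.
Context {R : realType} (n : nat) (c delta : R).
Context (delta_gt0 : 0 < delta) (delta_lt1 : delta < 1).
Local Notation ginst g := (ginst g n c delta_gt0 delta_lt1).

(** [va i] is the only leftmost vertex of its hyperedge, so the vertices [va i] form one colour
    class. *)
Lemma ginst_barG_bipartite : barG_bipartite (ginst false).
Proof.
exists (fun v => v \in [set va i | i in 'I_n.+1]%SET).
have leftmostE F u v : F \in hedges (ginst false) -> leftmost (ginst false) F u ->
    v \in F -> u != v ->
    (u \in [set va i | i in 'I_n.+1]%SET) && (v \notin [set va i | i in 'I_n.+1]%SET).
  rewrite inE => /existsP[i /eqP ->] /andP[uF /forall_inP lmin].
  have := lmin (va i); rewrite !inE eqxx orbT => /(_ isT).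
  move: uF; rewrite !inE => /orP[/orP[]|] /eqP -> /=; try lra.
  move=> _ vF uv; apply/andP; split; first exact: imset_f.
  by apply/imsetP => -[j _ vE]; move: vF uv; rewrite vE => /orP[/orP[]|] /eqP // ->; rewrite eqxx.
move=> u v /andP[uv /existsP[F /andP[FI /and4P[uF vF /orP[lm|lm] _]]]].
  by have /andP[-> /negbTE ->] := leftmostE _ _ _ FI lm vF uv.
by rewrite eq_sym in uv; have /andP[-> /negbTE ->] := leftmostE _ _ _ FI lm uF uv.
Qed.

Lemma ginst_graph_instance : graph_instance (ginst true).
Proof.
by move=> F; rewrite inE => /existsP[i /or3P[]] /eqP->; rewrite cards2; case: eqP.
Qed.

(** The edges at index 0 form a triangle. *)
Lemma ginst_not_bipartite : ~ graph_bipartite (ginst true).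
Proof.
move=> [col colP].
have edge F : F \in [set [set None; va ord0]; [set None; vb ord0];
    [set va ord0; vb (@ord0 n)]]%SET -> F \in hedges (ginst true).
  by rewrite !inE -orbA => eF; apply/existsP; exists ord0.
have diff u v : [set u; v]%SET \in hedges (ginst true) -> u != v -> col u != col v.
  by move=> E; apply: (colP _ E); rewrite !inE eqxx ?orbT.
have xa : col None != col (va ord0).
  by apply: diff => //; apply: edge; rewrite !inE eqxx.
have xb : col None != col (vb ord0).
  by apply: diff => //; apply: edge; rewrite !inE eqxx orbT.
have ab : col (va ord0) != col (vb ord0).
  by apply: diff => //; apply: edge; rewrite !inE eqxx !orbT.
by move: xa xb ab; case: (col None); case: (col (va ord0)); case: (col (vb ord0)).
Qed.

End gadget_classes.

Lemma ginst_single_hyperedge (R : realType) (c delta : R)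
    (d0 : 0 < delta) (d1 : delta < 1) :
  single_hyperedge (ginst false 0 c d0 d1).
Proof.
exists [set None; va ord0; vb (@ord0 0)]%SET; apply/setP => F; rewrite !inE.
apply/existsP/eqP => [[i /eqP ->]|->]; last by exists ord0.
by rewrite (ord1 i).
Qed.

(** * Choice of the parameters *)

Lemma exists_small_delta (R : realType) (eta : R) (m : nat) : 0 < eta -> (0 < m)%N ->
  exists delta : R, [/\ 0 < delta, delta < 1, 12 * (m%:R * delta) <= eta & m%:R * delta < 1].
Proof.
move=> eta0 m0; have mR : 1 <= m%:R :> R by rewrite ler1n.
(* The factor [1 + eta] exceeds both 1 and [eta], which keeps [x] below [eta / 12] and below 1;
   [delta] is [x / m]. *)
pose x := eta / (1 + eta) / 12.
have e1 : 0 < 1 + eta by lra.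
have xE : x * 12 * (1 + eta) = eta by rewrite /x; field; rewrite gt_eqF.
have x0 : 0 < x by rewrite /x !divr_gt0.
have mx : m%:R * (x / m%:R) = x by rewrite mulrC divfK// gt_eqF//; lra.
exists (x / m%:R); rewrite mx.
have xeta : 12 * x <= eta by nra.
have x1 : x < 1 by nra.
split => //; first by rewrite divr_gt0//; lra.
by rewrite ltr_pdivrMr ?mul1r; lra.
Qed.

Theorem theorem2p5 (R : realType) (eta : R) : 0 < eta ->
  [/\ (* general instances *)
      exists (V : finType) (I : instance R V),
        wf_instance I /\ vc_lower_bound I eta,
      (* (1) a single hyperedge, non-uniform query costs *)
      exists (V : finType) (I : instance R V),
        [/\ wf_instance I, single_hyperedge I, nonuniform_costs I &
            vc_lower_bound I eta],
      (* (2) uniform query costs, bipartite vertex cover instance *)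
      exists (V : finType) (I : instance R V),
        [/\ wf_instance I, uniform_costs I, barG_bipartite I &
            vc_lower_bound I eta] &
      (* (3) graph orientation, uniform costs, non-bipartite graph *)
      exists (V : finType) (I : instance R V),
        [/\ wf_instance I, graph_instance I, uniform_costs I,
            ~ graph_bipartite I & vc_lower_bound I eta]].
Proof.
move=> eta0.
have [n n_big] : exists n, 3 * 1 <= eta * n.+1%:R.
  (* Enough pairs make the unit cost of the hub negligible. *)
  exists (Num.truncn (3 / eta)); rewrite mulr1 mulrC -ler_pdivrMr//.
  by rewrite ltW// Num.Theory.truncnS_gt.
have [delta [d0 d1 hd hd1]] := exists_small_delta eta0 (ltn0Sn (2 * n.+1)).
have unif g : uniform_costs (ginst g n 1 d0 d1) by case.
have wf g : wf_instance (ginst g n 1 d0 d1) by apply: ginst_wf.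
have bound g : vc_lower_bound (ginst g n 1 d0 d1) eta by apply: ginst_vc_lower_bound.
split.
- by exists (vtx n), (ginst true n 1 d0 d1).
- have [delta' [d0' d1' hd' hd1']] := exists_small_delta eta0 (ltn0Sn (2 * 1)).
  (* One pair of leaves ([n = 0]) suffices when the hub is free ([c = 0]), which also makes the
     costs non-uniform. *)
  exists (vtx 0), (ginst false 0 0 d0' d1'); split.
  + exact: ginst_wf.
  + exact: ginst_single_hyperedge.
  + by exists None, (va ord0); rewrite /= eq_sym oner_eq0.
  + by apply: ginst_vc_lower_bound => //; rewrite mulr0 mulr_ge0// ltW.
- exists (vtx n), (ginst false n 1 d0 d1); split => //.
  exact: ginst_barG_bipartite.
- exists (vtx n), (ginst true n 1 d0 d1); split => //.
    exact: ginst_graph_instance.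
  exact: ginst_not_bipartite.
Qed.
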